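(* Let $(E,\mathcal{E})$ be a measurable space with $E\subseteq\mathbb{R}$, let $C\in\mathcal{E}$, let $\hat Q$ be a probability measure on $(\hat E,\hat{\mathcal{E}})$ such that $0<\|\ell_C\|_{L^2(\hat Q)}<\infty$, and let $\mathcal{G}$ be a class of measurable real-valued functions on $(E,\mathcal{E})$. Put $\hat{\mathcal{G}}_C=\{\hat g_C: g\in\mathcal{G}\}$. Then for every $0<\epsilon<\infty$, $$\mathcal{N}\big(\epsilon\|\ell_C\|_{L^2(\hat Q)},\hat{\mathcal{G}}_C,L^2(\hat Q)\big)\le\mathcal{N}\big(\epsilon,\mathcal{G},L^2(Q_C)\big),$$ where $Q_C$ is the probability measure on $(E,\mathcal{E})$ given by $$Q_C(A)=\frac{\mathbb{E}_{\hat Q}\big(\ell_C(B)\int_A M_C(B,dy)\big)}{\mathbb{E}_{\hat Q}(\ell_C^2)},\qquad A\in\mathcal{E}.$$ Moreover, if $\mathcal{G}$ is VC with constant envelope $U$ and characteristic $(\mathbf{C},v)$, then $\hat{\mathcal{G}}_C$ is VC with envelope $U\ell_C$ and characteristic $(\mathbf{C},v)$.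
   Context: $\hat E=\bigcup_{k\ge1}E^k$ is the set of finite sequences (blocks) of elements of $E$, and $\hat{\mathcal{E}}$ is the smallest $\sigma$-algebra formed by the elements of the product $\sigma$-algebras $\mathcal{E}^k$, $k\ge1$. For a block $B\in\hat E$, the localized occupation measure is $M_C(B,dy)=\sum_{x\in B\cap C}\delta_x(dy)$, the sum being over the entries of $B$ that lie in $C$ (with multiplicity); $\ell_C(B)=\int M_C(B,dy)$ is the number of entries of $B$ lying in $C$. For $g:E\to\mathbb{R}$, $\hat g_C(B)=\int g(y)M_C(B,dy)=\sum_{x\in B\cap C}g(x)$. In the definition of $Q_C$, $B$ is a random block with law $\hat Q$. For a probability measure $\mu$ and a class of functions $\mathcal{H}$, $\mathcal{N}(\epsilon,\mathcal{H},L^2(\mu))$ is the minimum number of $L^2(\mu)$ balls of radius $\epsilon$ needed to cover $\mathcal{H}$. A class $\mathcal{H}$ is VC with envelope $U$ and characteristic $(\mathbf{C},v)$ if $|h|\le U$ for all $h\in\mathcal{H}$ and $\mathcal{N}(\epsilon\|U\|_{L^2(\mu)},\mathcal{H},L^2(\mu))\le\mathbf{C}\epsilon^{-v}$ for every $0<\epsilon<1$ and every probability measure $\mu$ with $0<\|U\|_{L^2(\mu)}<\infty$. *)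

(* Defs.v *)
From HB Require Import structures.
From mathcomp Require Import all_boot all_order all_algebra.
From mathcomp Require Import all_classical all_reals all_analysis.

Set Implicit Arguments.
Unset Strict Implicit.
Unset Printing Implicit Defensive.
Import Order.TTheory GRing.Theory Num.Theory.
Import numFieldNormedType.Exports.

Local Open Scope classical_set_scope.
Local Open Scope ring_scope.

(* A block of length k >= 1 is encoded with the index k.-1. *)
Definition raw_block (E : Type) := {k : nat & k.+1.-tuple E}.

HB.instance Definition _ (E : Type) := gen_eqMixin (raw_block E).
HB.instance Definition _ (E : Type) := gen_choiceMixin (raw_block E).
HB.instance Definition _ (E : pointedType) :=
  isPointed.Build (raw_block E) (existT _ 0%N [tuple point]).

Definition block_gen d (E : measurableType d) : set (set (raw_block E)) :=
  [set A | exists k, exists2 X : set (k.+1.-tuple E),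
     measurable X & A = existT _ k @` X].

Definition block d (E : measurableType d) :=
  g_sigma_algebraType (@block_gen d E).

Definition block_seq d (E : measurableType d) (B : block E) : seq E :=
  tval (projT2 (B : raw_block E)).
Coercion block_seq : block >-> seq.

Section localized.
Context d (E : measurableType d) (R : realType).
Implicit Types (C A : set E) (B : block E) (g : E -> R).

Definition occ C B A : \bar R := (\sum_(x <- B | x \in C) \d_x A)%E.

Definition ell C B : R := (count (fun x => x \in C) B)%:R.

Definition hat C g B : R := \sum_(x <- B | x \in C) g x.

Let occ0 C B : occ C B set0 = 0%E.
Proof. by rewrite /occ big1// => x _; rewrite measure0. Qed.

Let occ_ge0 C B A : (0 <= occ C B A)%E.
Proof. by rewrite /occ sume_ge0. Qed.

Let occ_sigma_additive C B : semi_sigma_additive (occ C B).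
Proof.
move=> F mF tF mUF.
rewrite [X in _ --> X](_ : _ = \sum_(0 <= i <oo) occ C B (F i))%E.
  by apply: is_cvg_ereal_nneg_natsum => n _; exact: occ_ge0.
rewrite /occ nneseries_sum; last by move=> *; exact: measure_ge0.
by apply: eq_bigr => x _; rewrite measure_semi_bigcup.
Qed.

HB.instance Definition _ C B := isMeasure.Build _ _ _ (occ C B)
  (occ0 C B) (occ_ge0 C B) (@occ_sigma_additive C B).

End localized.
Arguments occ {d E R} C B A.
Arguments ell {d E R} C B.
Arguments hat {d E R} C g B.

Section covering.
Context d (T : measurableType d) (R : realType).
Implicit Types (mu : probability T R) (H : set (T -> R)).
Local Open Scope ereal_scope.

(* Open ball in L^2(mu); its elements are functions, not classes modulo
   almost-everywhere equality. *)
Definition L2ball mu (c : T -> R) (r : \bar R) : set (T -> R) :=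
  [set f | f \in Lfun mu 2%:E /\ 'N[mu]_2%:E[EFin \o (f \- c)%R] < r].

(* The centers are arbitrary elements of L^2(mu), not necessarily in H. *)
Definition L2covered mu (r : \bar R) H (n : nat) :=
  exists2 c : 'I_n -> T -> R, (forall i, c i \in Lfun mu 2%:E) &
    H `<=` \bigcup_i L2ball mu (c i) r.

(* Equals +oo when no finite cover exists. *)
Definition covnum mu (r : \bar R) H : \bar R :=
  ereal_inf [set n%:R%:E | n in L2covered mu r H].

Definition VC H (U : T -> R) (K v : R) :=
  (forall h x, H h -> (`|h x| <= U x)%R) /\
  (forall mu, 0 < 'N[mu]_2%:E[EFin \o U] < +oo ->
   forall eps : R, (0 < eps < 1)%R ->
     covnum mu (eps%:E * 'N[mu]_2%:E[EFin \o U]) H <= (K * eps `^ (- v))%:E).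

End covering.

(* Main.v *)
Require Import Defs.
From HB Require Import structures.
From mathcomp Require Import all_boot all_order all_algebra.
From mathcomp Require Import all_classical all_reals all_analysis.
From mathcomp Require Import measurable_realfun.
From mathcomp Require Import ring lra.

(**
Write N for the L^2(Q)-norm of the block length [ell C]. The whole statement
follows from one Lipschitz estimate for the linear map [g |-> hat C g]: for
measurable h,

   ||hat C h||_{L^2(Q)}  <=  N * ||h||_{L^2(QC)}            ([Lnorm2_hat_le]).

It is Cauchy-Schwarz inside each block followed by a change of measure. A sum
of [ell C B] terms satisfies (sum h)^2 <= ell C B * sum h^2 ([sqr_hat_le]),
and QC is exactly the measure for which averaging the right-hand side over
the random block B gives N^2 * int h^2 dQC ([integral_entry_law]): that is
the reason for the extra factor [ell C B] in its definition.

Since [hat C (g - c)] is [hat C g - hat C c], this estimate sends the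
L^2(QC)-ball of radius r around c into the L^2(Q)-ball of radius r * N around
[hat C c], so the images of the centers of a cover of G are the centers of a
cover of [hat C @` G] with as many balls ([covnum_hat_le]). The VC property
([VC_hat]) is this comparison for an arbitrary law of blocks with r = eps * |U|,
because the norm of the constant envelope U is |U| under every probability
measure, while the norm of [U * ell C] is |U| * N.

The measure theory behind it is the construction of QC: it is the normalization
of the mixture over B of the measures [ell C B * occ C B], and the identity for
integrals against a mixture ([integral_mixture]) is extended from simple
functions by monotone convergence.
*)

Set Implicit Arguments.
Unset Strict Implicit.
Unset Printing Implicit Defensive.
Import Order.TTheory GRing.Theory Num.Theory.
Import numFieldNormedType.Exports.

Local Open Scope classical_set_scope.
Local Open Scope ring_scope.

(** * Mixtures of measures along a kernel *)

Section mixture.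
Local Open Scope ereal_scope.
Context d d' (X : measurableType d) (Y : measurableType d') (R : realType).
Variables (mu : {measure set X -> \bar R}) (k : R.-ker X ~> Y).

Definition mixture (A : set Y) : \bar R := \int[mu]_x k x A.

Let mixture0 : mixture set0 = 0.
Proof. by apply: integral0_eq => x _; rewrite measure0. Qed.

Let mixture_ge0 A : 0 <= mixture A.
Proof. by apply: integral_ge0 => x _; exact: measure_ge0. Qed.

Let mixture_sigma_additive : semi_sigma_additive mixture.
Proof.
move=> F mF tF mUF; rewrite [X in _ --> X](_ : _ =
    \sum_(0 <= n <oo) mixture (F n)).
  by apply: is_cvg_ereal_nneg_natsum => n _; exact: mixture_ge0.
rewrite -integral_nneseries//; last by move=> n; exact: measurable_kernel.
by apply: eq_integral => x _; exact: measure_semi_bigcup.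
Qed.

HB.instance Definition _ := isMeasure.Build _ _ _ mixture
  mixture0 mixture_ge0 mixture_sigma_additive.

Import HBNNSimple.

Let sintegral_mixture (h : {nnsfun Y >-> R}) :
  sintegral mixture h = \int[mu]_x sintegral (k x) h.
Proof.
have mk r : measurable_fun [set: X] (k ^~ (h @^-1` [set r])).
  by apply: measurable_kernel; exact: measurable_funPTI.
under eq_integral do rewrite sintegralE.
rewrite ge0_integral_fsum//; last 2 first.
- by move=> r; exact: measurable_funeM.
- by move=> r x _; exact: nnsfun_mulemu_ge0.
rewrite sintegralE; apply: eq_fsbigr => r; rewrite inE => -[y _ <-].
by rewrite ge0_integralZl// lee_fin.
Qed.

(** Both sides are linear and continuous along nondecreasing sequences of f:
the formula passes from simple functions to their limits. *)
Lemma integral_mixture (f : Y -> \bar R) : (forall y, 0 <= f y) ->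
  measurable_fun setT f ->
  \int[mixture]_y f y = \int[mu]_x \int[k x]_y f y.
Proof.
move=> f0 mf; pose g := nnsfun_approx measurableT mf.
have mg n : measurable_fun setT (EFin \o g n) by exact/measurable_EFinP.
have g0 n y : 0 <= (EFin \o g n) y by rewrite lee_fin.
have ndg y : {homo (fun n => (EFin \o g n) y) : m n / (m <= n)%O >-> m <= n}.
  by move=> *; exact/lefP/nd_nnsfun_approx.
(* Stated for every measure, as it serves both for the mixture and for each
   of its components. *)
have limg (nu : {measure set Y -> \bar R}) :
    \int[nu]_y f y = limn (fun n => \int[nu]_y (EFin \o g n) y).
  rewrite -monotone_convergence//; apply: eq_integral => y _.
  by apply/esym/cvg_lim => //; exact: cvg_nnsfun_approx.
rewrite limg; under [RHS]eq_integral do rewrite limg.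
rewrite monotone_convergence//.
- by apply: congr_lim; apply/funext => n; rewrite integralT_nnsfun
    sintegral_mixture; apply: eq_integral => x _; rewrite integralT_nnsfun.
- move=> n; apply: measurable_fun_integral_kernel => //.
  exact: measurable_kernel.
- by move=> n x _; exact: integral_ge0.
- by move=> x _ m n mn; apply: ge0_le_integral => // y _; exact: ndg.
Qed.

End mixture.

(** * Normalized measures and the quadratic norm *)

Section normalization.
Local Open Scope ereal_scope.
Context d (T : measurableType d) (R : realType).

Lemma mnormalizeE (mu : {measure set T -> \bar R}) (P : probability T R) A :
  0 < mu setT < +oo -> mnormalize mu P A = mu A / mu setT.
Proof.
move=> /andP[mu0 muoo]; have mufin : mu setT \is a fin_num.
  by rewrite ge0_fin_numE.
rewrite /mnormalize gt_eqF// lt_eqF//=; congr (_ * _).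
by rewrite -[in RHS](fineK mufin) inver fine_eq0// gt_eqF.
Qed.

Lemma ge0_integral_mnormalize (mu : {measure set T -> \bar R})
    (P : probability T R) (f : T -> \bar R) :
  0 < mu setT < +oo -> (forall x, 0 <= f x) -> measurable_fun setT f ->
  \int[mu]_x f x = mu setT * \int[mnormalize mu P]_x f x.
Proof.
move=> mu_fin f0 mf; have /andP[mu0 muoo] := mu_fin.
have muE : mu setT = (fine (mu setT))%:E.
  by rewrite fineK// ge0_fin_numE// ltW.
have m0 : (0 < fine (mu setT))%R by rewrite fine_gt0// mu0.
have i0 : (0 <= fine (mu setT))%R by rewrite ltW.
rewrite [in RHS]muE -[in RHS](ge0_integral_mscale _ measurableT (NngNum i0))//.
apply: eq_measure_integral => A mA _.
rewrite /= /mscale /= mnormalizeE// -muE muleCA divee ?mule1//.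
  by rewrite ge0_fin_numE.
by rewrite gt_eqF.
Qed.

Lemma Lnorm2E (mu : {measure set T -> \bar R}) (f : T -> R) :
  'N[mu]_2%:E[EFin \o f] = (\int[mu]_x (f x ^+ 2)%:E) `^ 2^-1.
Proof.
rewrite unlock; congr (_ `^ _); apply: eq_integral => x _ /=.
by rewrite powR_mulrn// real_normK// num_real.
Qed.

Lemma Lnorm2_scale (mu : {measure set T -> \bar R}) (a : R) (f : T -> R) :
  measurable_fun setT f ->
  'N[mu]_2%:E[EFin \o (fun x => a * f x)%R] =
  `|a|%:E * 'N[mu]_2%:E[EFin \o f].
Proof.
move=> mf; rewrite !Lnorm2E.
under eq_integral do rewrite exprMn EFinM.
rewrite ge0_integralZl ?lee_fin ?sqr_ge0//; last 2 first.
- by apply/measurable_EFinP; exact: measurable_funX.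
- by move=> x _; rewrite lee_fin sqr_ge0.
rewrite poweRM ?lee_fin ?sqr_ge0//; last first.
  by apply: integral_ge0 => x _; rewrite lee_fin sqr_ge0.
by rewrite poweR_EFin powR12_sqrt ?sqr_ge0// sqrtr_sqr.
Qed.

Lemma Lnorm2_cst (P : probability T R) (a : R) :
  'N[P]_2%:E[EFin \o cst a] = `|a|%:E.
Proof.
rewrite Lnorm2E -[integral _ _ _]/(\int[P]_x cst (a ^+ 2)%:E x).
rewrite integral_cst//= probability_setT mule1 poweR_EFin.
by rewrite powR12_sqrt ?sqr_ge0// sqrtr_sqr.
Qed.

Lemma Lfun2P (mu : {measure set T -> \bar R}) (f : T -> R) :
  f \in Lfun mu 2%:E <->
  measurable_fun setT f /\ 'N[mu]_2%:E[EFin \o f] < +oo.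
Proof.
split; first by move=> /andP[/[!inE]/=].
by move=> [mf nf]; apply/andP; split; rewrite inE.
Qed.

End normalization.

(** * Functions of a random block *)

Section blocks.
Context d (E : measurableType d) (R : realType).
Implicit Types (C A : set E) (B : block E) (g : E -> R).

(** The block space is the disjoint union of the tuple spaces, so a preimage is
a countable union of images of measurable sets of tuples, that is, of
generators of its sigma-algebra. *)
Lemma measurable_fun_block d' (T : measurableType d') (f : block E -> T) :
  (forall k, measurable_fun setT
     (fun t : k.+1.-tuple E => f (existT _ k t : raw_block E))) ->
  measurable_fun setT f.
Proof.
move=> mf _ Y mY; rewrite setTI.
have -> : f @^-1` Y = \bigcup_k ((fun t : k.+1.-tuple E =>
    existT _ k t : raw_block E) @`
    ((fun t : k.+1.-tuple E => f (existT _ k t : raw_block E)) @^-1` Y)).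
  apply/seteqP; split => [[k t] Yt|_ [k _ [t Yt <-]]//].
  by exists k => //; exists t.
apply: bigcup_measurable => k _; apply: sub_sigma_algebra.
by exists k; eexists; last reflexivity; rewrite -[X in measurable X]setTI;
  exact: mf.
Qed.

Lemma measurable_hat C g : measurable C -> measurable_fun setT g ->
  measurable_fun setT (hat C g).
Proof.
move=> mC mg; apply: measurable_fun_block => k.
rewrite (_ : (fun t => _) = (fun t : k.+1.-tuple E =>
    \sum_(i < k.+1) \1_C (tnth t i) * g (tnth t i))); last first.
  apply/funext => t; rewrite /hat /block_seq/= big_mkcond big_tuple.
  by apply: eq_bigr => i _; rewrite indicE; case: ifP; rewrite ?mul1r ?mul0r.
apply: measurable_sum => i.
have mi : measurable_fun setT (fun t : k.+1.-tuple E => tnth t i).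
  exact: measurable_tnth.
have mC1 : measurable_fun setT (\1_C : E -> R) by exact: measurable_indic.
by apply: measurable_funM; [exact: (measurableT_comp mC1 mi)|
  exact: (measurableT_comp mg mi)].
Qed.

Lemma ell_hat C : ell C = hat C (cst 1 : E -> R).
Proof.
by apply/funext => B; rewrite /ell /hat -sum1_count natr_sum.
Qed.

Lemma measurable_ell C : measurable C -> measurable_fun setT (ell C : _ -> R).
Proof. by move=> mC; rewrite ell_hat; exact: measurable_hat. Qed.

Lemma ell_ge0 C B : 0 <= ell C B :> R. Proof. exact: ler0n. Qed.

(** Reduces the measurability of the kernel [B |-> occ C B] to [measurable_hat]. *)
Lemma occE C B A : occ C B A = (hat C (\1_A : E -> R) B)%:E.
Proof. by rewrite /occ /hat -sumEFin. Qed.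

Lemma hatB C f g B : hat C (f \- g) B = hat C f B - hat C g B.
Proof. by rewrite /hat sumrB. Qed.

Lemma ler_norm_hat C g (U : R) B : (forall x, `|g x| <= U) ->
  `|hat C g B| <= U * ell C B.
Proof.
move=> gU; rewrite (le_trans (ler_norm_sum _ _ _))// ell_hat /hat mulr_sumr.
by apply: ler_sum => x _; rewrite mulr1.
Qed.

(** Cauchy-Schwarz for the scalar product of g with the constant 1 over the
entries of B in C. *)
Lemma sqr_hat_le C g B :
  hat C g B ^+ 2 <= ell C B * hat C (fun x => g x ^+ 2) B.
Proof.
(* The quadratic polynomial in t below is the sum of the squares (g x - t)^2,
   so its discriminant is nonpositive; this covers blocks missing C, for which
   the leading coefficient vanishes. *)
have quad_ge0 t : 0 <= ell C B * t ^+ 2 + (- 2 * hat C g B) * t +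
    hat C (fun x => g x ^+ 2) B.
  rewrite ell_hat /hat mulr_suml mulr_sumr mulr_suml -!big_split/=.
  apply: sumr_ge0 => x _; rewrite [leRHS](_ : _ = (g x - t) ^+ 2) ?sqr_ge0//.
  by ring.
have := @deg_le2_poly_ge0 _
  (Poly [:: hat C (fun x => g x ^+ 2) B; - 2 * hat C g B; ell C B]).
rewrite !coef_Poly => /(_ (size_Poly _)) h.
suff : (- 2 * hat C g B) ^+ 2 -
    4 * ell C B * hat C (fun x => g x ^+ 2) B <= 0 by move=> ?; lra.
apply: h => t; rewrite horner_Poly/= mul0r add0r.
by have := quad_ge0 t; lra.
Qed.

Lemma integral_occ C B (f : E -> R) : (forall x, 0 <= f x) ->
  measurable_fun setT f -> (\int[occ C B]_x (f x)%:E = (hat C f B)%:E)%E.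
Proof.
move=> f0 mf.
(* Indexing the entries by position keeps their multiplicities and presents the
   occupation measure as a finite sum of measures indexed by naturals. *)
pose m n : {measure set E -> \bar R} :=
  if nth point B n \in C then dirac (nth point B n) : {measure set E -> \bar R}
  else mzero.
rewrite (@eq_measure_integral _ _ _ setT (msum m (size B)))//.
  rewrite ge0_integral_measure_sum//; last 2 first.
  - by move=> x _; rewrite lee_fin.
  - exact/measurable_EFinP.
  rewrite /hat (big_nth point) big_mkord -sumEFin [RHS]big_mkcond.
  apply: eq_bigr => i _; rewrite /m; case: ifP => _.
    by rewrite integral_dirac ?diracT ?mul1e//; exact/measurable_EFinP.
  by rewrite integral_measure_zero.
move=> A mA _; rewrite /= /occ (big_nth point) big_mkord [LHS]big_mkcond/= /msum.
by apply: eq_bigr => i _; rewrite /m; case: ifP.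
Qed.

(** Taking the measurability of C as an argument lets the kernel structure be
attached to this function. *)
Definition sized_occ C (mC : measurable C) B : {measure set E -> \bar R} :=
  mscale (NngNum (ell_ge0 C B)) (occ C B).

Lemma sized_occE C (mC : measurable C) B A :
  sized_occ mC B A = (ell C B * hat C \1_A B)%:E.
Proof. by rewrite /sized_occ /= /mscale /= occE. Qed.

Let measurable_sized_occ C (mC : measurable C) A : measurable A ->
  measurable_fun [set: block E] (sized_occ mC ^~ A).
Proof.
move=> mA; under eq_fun do rewrite sized_occE.
apply/measurable_EFinP; apply: measurable_funM; first exact: measurable_ell.
by apply: measurable_hat => //; exact: measurable_indic.
Qed.

HB.instance Definition _ C (mC : measurable C) :=
  isKernel.Build _ _ _ _ _ (sized_occ mC) (measurable_sized_occ mC).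

End blocks.

(** * The law of an entry of a length-biased block *)

Section entry_law.
Local Open Scope ereal_scope.
Context d (E : measurableType d) (R : realType).
Variables (C : set E) (mC : measurable C) (Q : probability (block E) R).

(** The measure QC. A block is drawn with density proportional to
[ell C B ^+ 2], then one of its entries in C uniformly. The Dirac mass only
serves as the value of the normalization when the mixture has mass 0 or
+oo. *)
Definition entry_law : probability E R :=
  mnormalize (mixture Q (sized_occ R mC)) (dirac point).

Hypothesis ellQ : 0 < 'N[Q]_2%:E[EFin \o ell C] < +oo.

Let m2 := \int[Q]_B (ell C B ^+ 2)%:E.

Let m2_ge0 : 0 <= m2.
Proof. by apply: integral_ge0 => B _; rewrite lee_fin sqr_ge0. Qed.

Let M : {measure set E -> \bar R} := mixture Q (sized_occ R mC).

Let mass_mixture : M setT = m2.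
Proof.
apply: eq_integral => B _; rewrite sized_occE indicT.
by rewrite -/(cst 1%R) -ell_hat.
Qed.

Let m2_gt0_lty : 0 < m2 < +oo.
Proof.
move: ellQ; rewrite Lnorm2E -/m2 => /andP[N0 Noo]; apply/andP; split.
- rewrite lt0e m2_ge0 andbT; apply: contraTneq N0 => ->.
  by rewrite poweR0r// ltxx.
- by rewrite ltey; apply: contraTneq Noo => ->; rewrite poweRyr// ltxx.
Qed.

Lemma entry_lawE A : measurable A ->
  entry_law A = 'E_Q[(fun B => ell C B * \int[occ C B]_(y in A) 1)%R]
                / 'E_Q[(fun B => ell C B ^+ 2)%R].
Proof.
move=> mA; have /andP[m0 moo] := m2_gt0_lty.
rewrite unlock -/m2; transitivity (M A / m2).
  rewrite -mass_mixture; apply: (mnormalizeE (mu := M)).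
  by rewrite mass_mixture m0.
congr (_ / _).
apply: eq_integral => B _; rewrite sized_occE; congr (_ * _)%:E.
by rewrite /Rintegral integral_cst//= mul1e occE.
Qed.

(** The definition of QC extended from indicators to nonnegative functions. *)
Lemma integral_entry_law (f : E -> R) : (forall x, 0 <= f x)%R ->
  measurable_fun setT f ->
  \int[Q]_B (ell C B * hat C f B)%:E = m2 * \int[entry_law]_x (f x)%:E.
Proof.
move=> f0 mf; have mEf : measurable_fun setT (EFin \o f).
  exact/measurable_EFinP.
rewrite -mass_mixture -(ge0_integral_mnormalize (mu := M)) ?mass_mixture//.
rewrite integral_mixture//; apply: eq_integral => B _.
rewrite ge0_integral_mscale//; last by move=> x _; rewrite lee_fin.
by rewrite EFinM; congr (_ * _); exact/esym/integral_occ.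
Qed.

(** Integrates [sqr_hat_le] over the blocks. Both norms may be infinite, so
this also shows that [hat C] maps L^2(QC) into L^2(Q). *)
Lemma Lnorm2_hat_le (h : E -> R) : measurable_fun setT h ->
  'N[Q]_2%:E[EFin \o hat C h] <=
  'N[Q]_2%:E[EFin \o ell C] * 'N[entry_law]_2%:E[EFin \o h].
Proof.
move=> mh; have mh2 : measurable_fun setT (fun x => h x ^+ 2)%R.
  exact: measurable_funX.
rewrite !Lnorm2E -/m2 -poweRM//; last first.
  by apply: integral_ge0 => x _; rewrite lee_fin sqr_ge0.
rewrite -integral_entry_law//; last by move=> x; exact: sqr_ge0.
apply: gt0_ler_poweR; rewrite ?invr_ge0 ?in_itv/= ?leey ?andbT//.
- by apply: integral_ge0 => B _; rewrite lee_fin sqr_ge0.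
- apply: integral_ge0 => B _; rewrite lee_fin mulr_ge0// sumr_ge0// => x _.
  exact: sqr_ge0.
apply: ge0_le_integral => //.
- by move=> B _; rewrite lee_fin sqr_ge0.
- by apply/measurable_EFinP/measurable_funX; exact: measurable_hat.
- apply/measurable_EFinP/measurable_funM; first exact: measurable_ell.
  exact: measurable_hat.
- by move=> B _; rewrite lee_fin sqr_hat_le.
Qed.

(** The images of the centers cover. Strict inequalities are kept because N is
positive and finite. *)
Lemma covnum_hat_le (r : \bar R) (G : set (E -> R)) :
  covnum Q (r * 'N[Q]_2%:E[EFin \o ell C]) (hat C @` G) <=
  covnum entry_law r G.
Proof.
have /andP[N0 Noo] := ellQ.
have Lhat h : h \in Lfun entry_law 2%:E -> hat C h \in Lfun Q 2%:E.
  move=> /Lfun2P[mh nh]; apply/Lfun2P; split; first exact: measurable_hat.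
  by rewrite (le_lt_trans (Lnorm2_hat_le mh))// lte_mul_pinfty// ?ltW//
    ge0_fin_numE// ltW.
apply: ereal_inf_le_tmp => _ [n [c Lc Gc] <-]; exists n => //.
exists (fun i => hat C (c i)) => [i|_ [g Gg <-]]; first exact/Lhat/Lc.
have [i _ [Lg gc]] := Gc g Gg; exists i => //; split; first exact: Lhat.
have mgc : measurable_fun setT (g \- c i)%R.
  by apply: measurable_funB; [have /Lfun2P[] := Lg|have /Lfun2P[] := Lc i].
rewrite [X in 'N[_]__[X]](_ : _ = EFin \o hat C (g \- c i)%R); last first.
  by apply/funext => B /=; rewrite hatB.
rewrite (le_lt_trans (Lnorm2_hat_le mgc))// muleC.
by rewrite lte_pmul2r// ge0_fin_numE// ltW.
Qed.

End entry_law.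

(** * The VC property of block sums *)

(** U may be negative when G is empty, whence the absolute values. The
hypothesis on the norm of [U * ell C] forces U to be nonzero and the norm of
[ell C] to be positive and finite, which is what the existence of QC
requires. *)
Lemma VC_hat (R : realType) d (E : measurableType d) (C : set E)
    (mC : measurable C) (G : set (E -> R)) (U K v : R) :
  VC G (cst U) K v -> VC (hat C @` G) (fun B => U * ell C B) K v.
Proof.
move=> [envG coverG]; split=> [_ B [g Gg <-]|Q].
  by apply: ler_norm_hat => x; exact: envG.
rewrite Lnorm2_scale; last exact: measurable_ell.
set N := 'N[Q]_2%:E[EFin \o ell C]%E => /andP[UN0 UNoo] eps eps01.
have N0 : (0 < N)%E.
  by rewrite lt0e Lnorm_ge0 andbT; apply: contraTneq UN0 => ->;
    rewrite mule0 ltxx.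
have U0 : (0 < `|U|%:E)%E.
  by rewrite lte_fin lt_neqAle normr_ge0 andbT eq_sym; apply: contraTneq UN0
    => ->; rewrite mul0e ltxx.
have Noo : (N < +oo)%E.
  by rewrite ltey; apply: contraTneq UNoo => ->; rewrite gt0_muley ?ltxx.
have ellQ : (0 < 'N[Q]_2%:E[EFin \o ell C] < +oo)%E by rewrite N0 Noo.
rewrite muleA (le_trans (covnum_hat_le mC ellQ _ _))//.
have := coverG (entry_law mC Q); rewrite Lnorm2_cst; apply => //.
by rewrite U0 ltry.
Qed.

Theorem lemma5p2 (R : realType) (d : measure_display) (E : measurableType d)
    (toR : E -> R) (toR_inj : injective toR)
    (C : set E) (mC : measurable C)
    (Q : probability (block E) R)
    (ellQ : (0 < 'N[Q]_2%:E[EFin \o ell C] < +oo)%E)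
    (G : set (E -> R)) (mG : forall g, G g -> measurable_fun setT g) :
  (exists QC : probability E R,
     (forall A, measurable A ->
        QC A = ('E_Q[(fun B => ell C B * \int[occ C B]_(y in A) 1)%R]
                / 'E_Q[(fun B => ell C B ^+ 2)%R])%E) /\
     (forall eps : R, 0 < eps ->
        (covnum Q (eps%:E * 'N[Q]_2%:E[EFin \o ell C]) (hat C @` G)
         <= covnum QC eps%:E G)%E)) /\
  (forall U K v : R, VC G (cst U) K v ->
     VC (hat C @` G) (fun B => U * ell C B) K v).
Proof.
split; last by move=> U K v; exact: VC_hat.
exists (entry_law mC Q); split; first exact: entry_lawE.
by move=> eps _; exact: covnum_hat_le.
Qed.
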